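(* Let $\mathbb{T}$ be a time scale, let $a,b\in\mathbb{T}$ with $a<b$, and let $\alpha,\beta\in\mathbb{R}$ with $\alpha\neq\beta$. Consider the problem of minimizing $$\mathcal{L}[x]=\int_a^b\left((x^{\Delta}(t))^2+x^{\sigma}(t)+t\,x^{\Delta}(t)\right)\Delta t$$ over all $x\in C^1_{prd}([a,b],\mathbb{R})$ satisfying $x(a)=\alpha$ and $x(b)=\beta$. Then the global minimizer of this problem is $$x(t)=\frac{\alpha-\beta}{a-b}\,t+\frac{\beta a-b\alpha}{a-b},\qquad t\in[a,b].$$
   Context: A time scale $\mathbb{T}$ is a nonempty closed subset of $\mathbb{R}$, with the topology inherited from $\mathbb{R}$. The forward jump operator is $\sigma(t)=\inf\{s\in\mathbb{T}:s>t\}$ for $t<\sup\mathbb{T}$, with $\sigma(\sup\mathbb{T})=\sup\mathbb{T}$ if $\sup\mathbb{T}<+\infty$. The backward jump operator is $\rho(t)=\sup\{s\in\mathbb{T}:s<t\}$ for $t>\inf\mathbb{T}$, with $\rho(\inf\mathbb{T})=\inf\mathbb{T}$ if $\inf\mathbb{T}>-\infty$. A point $t$ is right-dense if $\sigma(t)=t$, left-dense if $\rho(t)=t$, left-scattered if $\rho(t)<t$. If $\sup\mathbb{T}$ is finite and left-scattered, $\mathbb{T}^{\kappa}=\mathbb{T}\setminus\{\sup\mathbb{T}\}$; otherwise $\mathbb{T}^\kappa=\mathbb{T}$. The interval $[a,b]$ means $[a,b]\cap\mathbb{T}$, itself regarded as a time scale (so $[a,b]^\kappa$ is defined accordingly).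 Write $f^{\sigma}=f\circ\sigma$. The delta derivative of $f$ at $t\in\mathbb{T}^{\kappa}$ is the real number $f^{\Delta}(t)$ such that for every $\varepsilon>0$ there is a neighborhood $U=(t-\delta,t+\delta)\cap\mathbb{T}$ with $|f(\sigma(t))-f(s)-f^{\Delta}(t)(\sigma(t)-s)|\le\varepsilon|\sigma(t)-s|$ for all $s\in U$. A function $g$ is piecewise rd-continuous if it is defined except possibly at finitely many right-dense points, is continuous at the right-dense points of its domain, has finite left-sided limits at left-dense points, and has finite right-sided limits at the exceptional points. $C^1_{prd}([a,b],\mathbb{R})$ is the set of continuous $f:[a,b]\to\mathbb{R}$ such that $f^{\Delta}$ exists for all except possibly finitely many $t\in[a,b]^{\kappa}$ and $f^{\Delta}$ is piecewise rd-continuous. The delta integral of a piecewise rd-continuous $f$ is $\int_c^d f(t)\Delta t=F(d)-F(c)$, where $F$ is continuous and $F^{\Delta}=f$ except possibly at finitely many right-dense points. An admissible function is one in $C^1_{prd}([a,b],\mathbb{R})$ satisfying the boundary conditions. The global minimizer is the unique admissible function at which $\mathcal{L}$ attains its minimum over all admissible functions. *)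

(* Defs.v *)
From mathcomp Require Import all_boot all_order all_algebra.
From mathcomp Require Import all_classical all_reals all_analysis.
Import Order.TTheory GRing.Theory Num.Theory.
Import numFieldNormedType.Exports.
Set Implicit Arguments.
Unset Strict Implicit.
Unset Printing Implicit Defensive.
Local Open Scope classical_set_scope.
Local Open Scope ring_scope.

(* Functions on a time scale T are represented by functions R -> R; every     *)
(* notion below depends only on their values at points of T.                  *)

Definition time_scale (R : realType) (T : set R) : Prop :=
  T !=set0 /\ closed T.

Definition sigma (R : realType) (T : set R) (t : R) : R :=
  let A := [set s | T s /\ t < s] in
  if `[< A !=set0 >] then inf A else t.

Definition rho (R : realType) (T : set R) (t : R) : R :=
  let A := [set s | T s /\ s < t] in
  if `[< A !=set0 >] then sup A else t.

(* The maximum of T, if any, is right-dense and its minimum, if any, is       *)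
(* left-dense; a one-sided limit taken on the empty side is vacuous, because  *)
(* the corresponding filter is improper.                                      *)
Definition right_dense (R : realType) (T : set R) (t : R) : Prop :=
  T t /\ sigma T t = t.

Definition left_dense (R : realType) (T : set R) (t : R) : Prop :=
  T t /\ rho T t = t.

Definition left_scattered (R : realType) (T : set R) (t : R) : Prop :=
  T t /\ rho T t < t.

Definition kappa (R : realType) (T : set R) : set R :=
  if `[< has_ubound T /\ left_scattered T (sup T) >]
  then T `\ sup T else T.

(* [is_delta_derive T f t l] : the delta derivative of f at t is l (it is     *)
(* meaningful for t in [kappa T], where l is unique).                         *)
Definition is_delta_derive (R : realType) (T : set R) (f : R -> R) (t l : R) :
    Prop :=
  forall e : R, 0 < e -> exists2 d : R, 0 < d &
    forall s : R, T s -> s \in `]t - d, t + d[ ->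
      `|f (sigma T t) - f s - l * (sigma T t - s)| <= e * `|sigma T t - s|.

Definition delta_differentiable (R : realType) (T : set R) (f : R -> R) :
    set R :=
  [set t | kappa T t /\ exists l, is_delta_derive T f t l].

(* The value is 0 where f is not delta differentiable.                        *)
Definition delta_derive (R : realType) (T : set R) (f : R -> R) (t : R) : R :=
  xget 0 [set l | is_delta_derive T f t l].

(* This concerns the partial function with domain D and values g; the values  *)
(* of g outside D are irrelevant. The exceptional points are sought in        *)
(* [kappa T], where delta derivatives live, but density is that of T.         *)
Definition piecewise_rd_continuous (R : realType) (T D : set R) (g : R -> R) :
    Prop :=
  [/\ D `<=` kappa T,
      finite_set (kappa T `\` D) /\ kappa T `\` D `<=` right_dense T,
      (forall t, D t -> right_dense T t ->
         g s @[s --> within D (nbhs t)] --> g t),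
      (forall t, left_dense T t ->
         exists l : R, g s @[s --> within D t^'-] --> l) &
      (forall t, (kappa T `\` D) t ->
         exists l : R, g s @[s --> within D t^'+] --> l)].

Definition C1prd (R : realType) (T : set R) (f : R -> R) : Prop :=
  [/\ {within T, continuous f},
      finite_set (kappa T `\` delta_differentiable T f) &
      piecewise_rd_continuous T (delta_differentiable T f) (delta_derive T f)].

Definition delta_antiderivative (R : realType) (T : set R) (f F : R -> R) :
    Prop :=
  {within T, continuous F} /\
  exists E : set R, [/\ finite_set E, E `<=` right_dense T &
    forall t, (kappa T `\` E) t -> is_delta_derive T F t (f t)].

(* The integral of a partial function defined off finitely many right-dense   *)
(* points is that of any total extension of it, since an antiderivative is    *)
(* allowed finitely many such exceptions. The value is 0 if there is no       *)
(* antiderivative.                                                            *)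
Definition delta_integral (R : realType) (T : set R) (f : R -> R) (c d : R) :
    R :=
  xget 0 [set v | exists2 F, delta_antiderivative T f F & v = F d - F c].

Definition ts_interval (R : realType) (T : set R) (a b : R) : set R :=
  T `&` [set` `[a, b]].

Definition admissible (R : realType) (T : set R) (a b alpha beta : R) :
    set (R -> R) :=
  [set x | [/\ C1prd (ts_interval T a b) x, x a = alpha & x b = beta]].

(* sigma and the delta derivative are those of the time scale [a, b]; this    *)
(* sigma agrees with that of T at every t < b.                                *)
Definition cost (R : realType) (T : set R) (a b : R) (x : R -> R) : R :=
  let I := ts_interval T a b in
  delta_integral I
    (fun t => delta_derive I x t ^+ 2 + x (sigma I t) + t * delta_derive I x t)
    a b.

Definition is_minimizer (R : realType) (A : set (R -> R)) (L : (R -> R) -> R)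
    (x : R -> R) : Prop :=
  A x /\ forall y, A y -> L x <= L y.

(* Uniqueness is as functions on the set I.                                   *)
Definition is_global_minimizer (R : realType) (I : set R)
    (A : set (R -> R)) (L : (R -> R) -> R) (x : R -> R) : Prop :=
  is_minimizer A L x /\
  forall y, is_minimizer A L y -> forall t, I t -> y t = x t.

(* Main.v *)
Require Import Defs.
From mathcomp Require Import all_boot all_order all_algebra.
From mathcomp Require Import all_classical all_reals all_analysis.
From mathcomp Require Import ring lra.
Import Order.TTheory GRing.Theory Num.Theory.
Import numFieldNormedType.Exports.
Set Implicit Arguments.
Unset Strict Implicit.
Unset Printing Implicit Defensive.
Local Open Scope classical_set_scope.
Local Open Scope ring_scope.

(** By the product rule, t x(t) has delta derivative x(sigma t) + t x'(t), writing
    x' for the delta derivative of x. So two of the three terms of the integrand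
    contribute b beta - a alpha for every admissible x, and what is left to minimize
    is the integral of x'^2. With c = (beta - alpha) / (b - a), the integral of
    c (x' - c) vanishes because of the boundary conditions, and therefore
      L[x] = c^2 (b - a) + (b beta - a alpha) + (integral of (x' - c)^2)
    ([cost_excess]). The affine function of slope c makes the last term zero, and any
    function that does so has derivative c off finitely many right-dense points, so
    it is that affine function.

    Two facts of time scale calculus carry this argument.

    A continuous function with nonnegative delta derivative off finitely many
    right-dense points is nondecreasing ([nondecreasing_off_finite], by the induction
    principle [time_scale_ind]). It gives the sign of the integral of (x' - c)^2, the
    independence of the integral from the antiderivative ([delta_integralE]) and the
    uniqueness of the minimizer.

    A piecewise rd-continuous function on a compact time scale has an antiderivative
    ([delta_antiderivative_exists]), in particular x'^2 has one. Without it the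
    integral in the cost could be the default value 0, which says nothing about x.
    The antiderivative is an infimum of majorants: functions U such that
    m (v - u) <= U(v) - U(u) whenever m is a lower bound of the integrand on [u, v).
    This is the lower Darboux integral, and the definition yields the antiderivative without
    partitions or measurability. *)

(** * Limits in terms of distances *)

Lemma nbhs_distP (R : realType) (t : R) (P : set R) :
  nbhs t P <-> exists2 d : R, 0 < d & forall s, `|s - t| < d -> P s.
Proof.
split=> [/nbhs_ballP[d d0 dP]|[d d0 dP]]; last apply/nbhs_ballP; exists d => // s.
  by move=> st; apply: dP; rewrite /ball /= distrC.
by rewrite /ball /= distrC; exact: dP.
Qed.

Lemma cvg_within_distP (R : realType) (D : set R) (g : R -> R) (t l : R) :
  g s @[s --> within D (nbhs t)] --> l <->
  forall e : R, 0 < e -> exists2 d : R, 0 < d &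
    forall s, D s -> `|s - t| < d -> `|g s - l| < e.
Proof.
rewrite cvgrPdist_lt; split=> gl e e0.
  have /nbhs_distP[d d0 dP] := gl e e0; exists d => // s Ds st.
  by rewrite distrC; exact: dP.
have [d d0 dP] := gl e e0.
rewrite near_withinE; apply/nbhs_distP; exists d => // s st Ds.
by rewrite distrC; exact: dP.
Qed.

Lemma within_continuous_distP (R : realType) (T : set R) (f : R -> R) :
  {within T, continuous f} <->
  forall t, T t -> forall e : R, 0 < e -> exists2 d : R, 0 < d &
    forall s, T s -> `|s - t| < d -> `|f s - f t| < e.
Proof.
rewrite -[{within T, continuous f}]/(continuous (f : subspace T -> R)).
rewrite subspace_continuousP.
by split=> fc t Tt; apply/cvg_within_distP; exact: fc.
Qed.

Lemma closed_adherent (R : realType) (T : set R) (x : R) : closed T ->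
  (forall e : R, 0 < e -> exists2 s, T s & `|s - x| < e) -> T x.
Proof.
move=> Tc xT; rewrite (closure_id T).1 // => A /nbhs_distP[d d0 dA].
by have [s Ts sx] := xT d d0; exists s; split=> //; exact: dA.
Qed.

(** * Jump operators and induction on a time scale *)

Lemma sigma_between (R : realType) (T : set R) (t s : R) : T s -> t < s ->
  t <= sigma T t /\ sigma T t <= s.
Proof.
move=> Ts ts; rewrite /sigma; case: asboolP => [_|]; last first.
  by case; exists s.
split; first by apply: lb_le_inf; [exists s|move=> r [_ /ltW]].
by apply: ge_inf; [exists t => r [_ /ltW]|].
Qed.

Lemma sigma_ge (R : realType) (T : set R) (t : R) : t <= sigma T t.
Proof.
rewrite /sigma; case: asboolP => [An0|//].
by apply: lb_le_inf => // r [_ /ltW].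
Qed.

Lemma sigma_mem (R : realType) (T : set R) (t : R) : closed T -> T t ->
  T (sigma T t).
Proof.
move=> Tc Tt; rewrite /sigma; case: asboolP => [An0|//].
apply: closed_adherent => // e e0.
have hi : has_inf [set s | T s /\ t < s].
  by split=> //; exists t => r [_ /ltW].
have [s [Ts ts] se] := inf_adherent e0 hi.
exists s => //; have := ge_inf hi.2 (conj Ts ts : [set s | T s /\ t < s] s).
by rewrite ltr_norml => ?; apply/andP; split; lra.
Qed.

Lemma right_dense_approx (R : realType) (T : set R) (t v d : R) :
  sigma T t = t -> T v -> t < v -> 0 < d ->
  exists s, [/\ T s, t < s & s < t + d].
Proof.
rewrite /sigma; case: asboolP => [An0 infE|An0 _] Tv tv d0; last first.
  by case: An0; exists v.
have hi : has_inf [set s | T s /\ t < s].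
  by split=> //; exists t => r [_ /ltW].
have [s [Ts ts] se] := inf_adherent d0 hi.
by exists s; split=> //; rewrite -[t in t + d]infE.
Qed.

(** The second alternative says that t is left-scattered: r is its predecessor. *)
Lemma left_dense_or_jump (R : realType) (T : set R) (t u : R) :
  closed T -> T t -> T u -> u < t ->
  (left_dense T t /\ forall d : R, 0 < d -> exists s, [/\ T s, t - d < s & s < t])
  \/ exists r, [/\ T r, r < t & sigma T r = t].
Proof.
move=> Tc Tt Tu ut.
pose A := [set s | T s /\ s < t].
have hs : has_sup A by split; [exists u|exists t => r [_ /ltW]].
have rhoE : rho T t = sup A by rewrite /rho; case: asboolP => // -[]; exists u.
have supt : sup A <= t by apply: ge_sup; [exact: hs.1|move=> r [_ /ltW]].
have [slt|lt_sup] := ltrP (sup A) t; [right|left]; last first.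
  have {}supE : sup A = t by lra.
  split=> [|d d0]; first by split=> //; rewrite rhoE.
  have [s [Ts st] ds] := sup_adherent d0 hs.
  by exists s; split=> //; rewrite -[t in t - d]supE.
exists (sup A).
have TA : T (sup A).
  apply: closed_adherent => // e e0.
  have [s [Ts st] ds] := sup_adherent e0 hs.
  exists s => //; have := sup_upper_bound hs (conj Ts st : A s).
  by rewrite ltr_norml => ?; apply/andP; split; lra.
split=> //.
have [_ sigt] := sigma_between Tt slt.
apply/eqP; rewrite eq_le sigt /= leNgt; apply/negP => lts.
have Ts : T (sigma T (sup A)) by exact: sigma_mem.
have := sup_upper_bound hs (conj Ts lts : A _).
have := sigma_ge T (sup A) => h1 h2.
have sigE : sigma T (sup A) = sup A by lra.
have [|s [Ts' s1 s2]] := @right_dense_approx _ T (sup A) t (t - sup A) sigE Tt slt.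
  by lra.
have := sup_upper_bound hs (conj Ts' _ : A s); lra.
Qed.

Lemma kappa_mem (R : realType) (T : set R) (t v : R) : T t -> T v -> t < v ->
  kappa T t.
Proof.
move=> Tt Tv tv; rewrite /kappa; case: asboolP => // -[ubT _].
by split=> //= tE; have := ub_le_sup ubT Tv; lra.
Qed.

Lemma kappa_sub (R : realType) (T : set R) : kappa T `<=` T.
Proof. by move=> t; rewrite /kappa; case: asboolP => // _ []. Qed.

(** The infimum t of the points of [u, v] where A fails belongs to T. The step for
    jumps or the step from the left, according to whether t is left-scattered or
    left-dense, gives A t; then the step to the right pushes the failures away
    from t. *)
Lemma time_scale_ind (R : realType) (T : set R) (u v : R) (A : set R) :
  closed T -> T u -> T v -> u <= v -> A u ->
  (forall t, T t -> u <= t -> t < v -> t < sigma T t -> A t -> A (sigma T t)) ->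
  (forall t, T t -> u <= t -> t < v -> sigma T t = t -> A t ->
     exists2 d : R, 0 < d & forall s, T s -> t < s -> s < t + d -> s <= v -> A s) ->
  (forall t, T t -> u < t -> t <= v -> left_dense T t ->
     (forall d : R, 0 < d -> exists s, [/\ T s, t - d < s & s < t]) ->
     (forall s, T s -> u <= s -> s < t -> A s) -> A t) ->
  A v.
Proof.
move=> Tc Tu Tv uv Au Asig Aright Aleft; apply: contrapT => nAv.
pose B := [set t | [/\ T t, u <= t, t <= v & ~ A t]].
have Bv : B v by [].
have lbB : has_lbound B by exists u => r [].
have hi : has_inf B by split=> //; exists v.
set t := inf B.
have tB s : B s -> t <= s by move=> Bs; exact: ge_inf Bs.
have ut : u <= t by apply: lb_le_inf; [exists v|move=> r []].
have tv : t <= v by exact: tB.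
have Tt : T t.
  apply: closed_adherent => // e e0.
  have [s Bs se] := inf_adherent e0 hi; have [Ts _ _ _] := Bs.
  exists s => //; have := tB _ Bs; rewrite -/t in se.
  by rewrite ltr_norml => ?; apply/andP; split; lra.
have At_lt s : T s -> u <= s -> s < t -> A s.
  move=> Ts us st; apply: contrapT => nAs.
  have : t <= s by apply: tB; split=> //; lra.
  lra.
have At : A t.
  have [<-//|utn] := eqVneq u t.
  have {}utn : u < t by rewrite lt_neqAle utn.
  have [[ld dense]|[r [Tr rt sigr]]] := left_dense_or_jump Tc Tt Tu utn.
    by apply: Aleft.
  have ur : u <= r.
    by rewrite leNgt; apply/negP => ru; have [_] := sigma_between Tu ru; lra.
  by rewrite -sigr; apply: Asig => //; [lra|rewrite sigr|exact: At_lt].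
have {}tv : t < v by rewrite lt_neqAle tv andbT; apply/eqP => E; rewrite E in At.
have [sigt sigv] := sigma_between Tv tv.
suff [x tx xB] : exists2 x, t < x & forall s, B s -> x <= s.
  by have := lb_le_inf hi.1 xB; rewrite -/t; lra.
have [sigE|sign] := eqVneq (sigma T t) t.
  have [d d0 Ad] := Aright t Tt ut tv sigE At.
  exists (t + d); first lra.
  move=> s Bs; have [Ts us sv nAs] := Bs; rewrite leNgt; apply/negP => sd.
  have ts := tB _ Bs; have [stE|stn] := eqVneq s t; first by rewrite stE in nAs.
  by apply: nAs; apply: Ad => //; rewrite lt_neqAle eq_sym stn.
have {}sigt : t < sigma T t by rewrite lt_neqAle eq_sym sign.
exists (sigma T t) => // s Bs; have [Ts us sv nAs] := Bs.
apply: (sigma_between _ _).2 => //; rewrite lt_neqAle (tB _ Bs) andbT.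
by apply/eqP => tsE; rewrite -tsE in nAs.
Qed.

(** * Rules for the delta derivative *)

Lemma is_delta_deriveD (R : realType) (T : set R) (f g : R -> R) (t k l m : R) :
  is_delta_derive T f t l -> is_delta_derive T g t m ->
  is_delta_derive T (fun s => f s + k * g s) t (l + k * m).
Proof.
move=> fl gm e e0.
have k1 : 0 < 1 + `|k| by have := normr_ge0 k; lra.
have e1 : 0 < e / (1 + `|k|) by rewrite divr_gt0.
have [d d0 dP] := fl _ e1; have [d' d'0 d'P] := gm _ e1.
exists (Num.min d d'); first by rewrite lt_min d0.
move=> s Ts; rewrite in_itv /= => /andP[].
rewrite ltrBlDr -ltrBlDl -[s < _]ltrBlDl !lt_min => /andP[s1 s2] /andP[s3 s4].
have /dP {}dP : s \in `]t - d, t + d[ by rewrite in_itv /=; apply/andP; split; lra.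
have /d'P {}d'P : s \in `]t - d', t + d'[ by rewrite in_itv /=; apply/andP; split; lra.
rewrite [leLHS](_ : _ = `|(f (sigma T t) - f s - l * (sigma T t - s)) +
   k * (g (sigma T t) - g s - m * (sigma T t - s))|); last by congr `| _ |; ring.
apply: le_trans (ler_normD _ _) _; rewrite normrM.
have -> : e * `|sigma T t - s| = e / (1 + `|k|) * `|sigma T t - s| +
   `|k| * (e / (1 + `|k|) * `|sigma T t - s|) by field; rewrite gt_eqF.
by apply: lerD; [exact: dP|apply: ler_wpM2l => //; exact: d'P].
Qed.

Lemma is_delta_derive_id (R : realType) (T : set R) (t : R) :
  is_delta_derive T id t 1.
Proof.
move=> e e0; exists 1 => // s _ _.
by rewrite mul1r subrr normr0 mulr_ge0 // ltW.
Qed.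

(** The error is s (f(sigma t) - f(s) - l (sigma t - s)) + l (s - t) (sigma t - s). *)
Lemma is_delta_deriveMid (R : realType) (T : set R) (f : R -> R) (t l : R) :
  is_delta_derive T f t l ->
  is_delta_derive T (fun s => s * f s) t (f (sigma T t) + t * l).
Proof.
move=> fl e e0.
pose M := `|t| + 1 + `|l|.
have M0 : 0 < M by rewrite /M; have := normr_ge0 t; have := normr_ge0 l; lra.
have e1 : 0 < e / M by rewrite divr_gt0.
have [d d0 dP] := fl _ e1.
exists (Num.min d (Num.min 1 (e / M))); first by rewrite !lt_min d0 e1 ltr01.
move=> s Ts; rewrite in_itv /= => /andP[].
rewrite ltrBlDr -ltrBlDl -[s < _]ltrBlDl !lt_min.
move=> /and3P[s1 s2 s3] /and3P[s4 s5 s6].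
have /dP {}dP : s \in `]t - d, t + d[ by rewrite in_itv /=; apply/andP; split; lra.
rewrite [leLHS](_ : _ = `|s * (f (sigma T t) - f s - l * (sigma T t - s)) +
   l * (s - t) * (sigma T t - s)|); last by congr `| _ |; ring.
apply: le_trans (ler_normD _ _) _; rewrite !normrM.
have -> : e * `|sigma T t - s| = (`|t| + 1) * (e / M * `|sigma T t - s|) +
   `|l| * (e / M) * `|sigma T t - s|.
  by rewrite [in LHS](_ : e = M * (e / M)); [rewrite /M; ring|field; rewrite gt_eqF].
apply: lerD.
  apply: ler_pM => //; last exact: dP.
  by have := ler_normB (s - t) (- t); rewrite normrN opprK subrK => h;
    apply: (le_trans h); rewrite addrC lerD2l ler_norml; apply/andP; split; lra.
apply: ler_wpM2r => //; apply: ler_wpM2l => //.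
by rewrite ler_norml; apply/andP; split; lra.
Qed.

(** No point of T close to t exceeds t, hence such points are at distance at least
    mu = sigma t - t from sigma t, and the error allowed there is at least e mu. *)
Lemma is_delta_derive_scattered (R : realType) (T : set R) (f : R -> R)
    (t l : R) :
  {within T, continuous f} -> T t -> t < sigma T t ->
  f (sigma T t) - f t = l * (sigma T t - t) -> is_delta_derive T f t l.
Proof.
move=> /within_continuous_distP fc Tt tsig fE e e0.
set mu := sigma T t - t.
have mu0 : 0 < mu by rewrite /mu; lra.
have e1 : 0 < e * mu / 2 by rewrite divr_gt0 // mulr_gt0.
have [d d0 dP] := fc t Tt _ e1.
have l0 : 0 < `|l| + 1 by have := normr_ge0 l; lra.
have e2 : 0 < e * mu / 2 / (`|l| + 1) by rewrite divr_gt0.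
exists (Num.min d (Num.min mu (e * mu / 2 / (`|l| + 1)))).
  by rewrite !lt_min d0 mu0.
move=> s Ts; rewrite in_itv /= => /andP[].
rewrite ltrBlDr -ltrBlDl -[s < _]ltrBlDl !lt_min.
move=> /and3P[s1 s2 s3] /and3P[s4 s5 s6].
have st : s <= t.
  rewrite leNgt; apply/negP => ts; have [_] := sigma_between Ts ts.
  by rewrite /mu in s5; lra.
have -> : `|sigma T t - s| = sigma T t - s by rewrite ger0_norm //; lra.
rewrite [leLHS](_ : _ = `|(f (sigma T t) - f t - l * (sigma T t - t)) +
   (f t - f s) + l * (s - t)|); last by congr `| _ |; ring.
rewrite fE subrr add0r; apply: le_trans (ler_normD _ _) _; rewrite normrM distrC.
have h1 : `|f s - f t| < e * mu / 2.
  by apply: dP => //; rewrite ltr_norml; apply/andP; split; lra.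
have h2 : `|l| * `|s - t| <= e * mu / 2.
  apply: (@le_trans _ _ ((`|l| + 1) * (e * mu / 2 / (`|l| + 1)))); last first.
    by rewrite mulrC divfK // gt_eqF.
  apply: ler_pM => //; first lra.
  by rewrite ler_norml; apply/andP; split; lra.
have : e * mu <= e * (sigma T t - s) by rewrite ler_pM2l // /mu; lra.
lra.
Qed.

(** The point s = t lies in every neighborhood, so the error at s = t is at most
    e (sigma t - t) for all e. *)
Lemma is_delta_derive_scatteredE (R : realType) (T : set R) (f : R -> R)
    (t l : R) :
  T t -> is_delta_derive T f t l ->
  f (sigma T t) - f t = l * (sigma T t - t).
Proof.
move=> Tt fl; apply/eqP; rewrite -subr_eq0 -normr_le0; apply/ler_addgt0Pr => e e0.
have k1 : 0 < 1 + `|sigma T t - t| by have := normr_ge0 (sigma T t - t); lra.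
have [|d d0 dP] := fl (e / (1 + `|sigma T t - t|)); first by rewrite divr_gt0.
have h : t \in `]t - d, t + d[ by rewrite in_itv /=; apply/andP; split; lra.
apply: (le_trans (dP t Tt h)); rewrite add0r mulrAC ler_pdivrMr // ler_pM2l //.
lra.
Qed.

(** The difference quotient over a jump determines the derivative at a
    right-scattered point. At any other point of [kappa T] there are points of T
    arbitrarily close to t and distinct from t: [kappa T] excludes exactly the case
    of a maximum of T that is isolated from the left. *)
Lemma is_delta_derive_unique (R : realType) (T : set R) (f : R -> R)
    (t u v l m : R) :
  closed T -> T u -> T v -> u < v -> kappa T t ->
  is_delta_derive T f t l -> is_delta_derive T f t m -> l = m.
Proof.
move=> Tc Tu Tv uv kt fl fm; have Tt := kappa_sub kt.
have [sigE|sign] := eqVneq (sigma T t) t; last first.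
  have := is_delta_derive_scatteredE Tt fl.
  rewrite (is_delta_derive_scatteredE Tt fm) => /mulIf -> //.
  by rewrite subr_eq0.
have approx d : 0 < d -> exists s, [/\ T s, s != t, t - d < s & s < t + d].
  move=> d0; have [tv|vt] := ltrP t v.
    have [s [Ts ts sd]] := right_dense_approx sigE Tv tv d0.
    by exists s; split=> //; [rewrite gt_eqF|lra].
  have ut : u < t by lra.
  have [[_ dense]|[r [Tr rt sigr]]] := left_dense_or_jump Tc Tt Tu ut.
    have [s [Ts ds st]] := dense d d0.
    by exists s; split=> //; [rewrite lt_eqF|lra].
  have [[w Tw tw]|nw] := pselect (exists2 w, T w & t < w).
    have [s [Ts ts sd]] := right_dense_approx sigE Tw tw d0.
    by exists s; split=> //; [rewrite gt_eqF|lra].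
  have Tmax w : T w -> w <= t.
    by move=> Tw; rewrite leNgt; apply/negP => tw; apply: nw; exists w.
  have supE : sup T = t.
    apply/eqP; rewrite eq_le ge_sup //=; last by exists t.
    by apply: ub_le_sup => //; exists t.
  exfalso; move: kt; rewrite /kappa; case: asboolP => [_ [_]|]; first exact.
  case; split; first by exists t.
  rewrite supE; split=> //.
  apply: (@le_lt_trans _ _ r) => //; rewrite /rho; case: asboolP => [_|[]]; last by exists r.
  apply: ge_sup; first by exists r.
  move=> s [Ts st]; rewrite leNgt; apply/negP => rs.
  by have [_] := sigma_between Ts rs; lra.
(* One point s != t in both neighborhoods bounds |l - m| by e. *)
apply/eqP; rewrite -subr_eq0 -normr_le0; apply/ler_addgt0Pr => e e0.
have e2 : 0 < e / 2 by lra.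
have [d d0 dP] := fl _ e2; have [d' d'0 d'P] := fm _ e2.
have [|s [Ts st]] := approx (Num.min d d'); first by rewrite lt_min d0.
rewrite ltrBlDr -ltrBlDl -[s < _]ltrBlDl !lt_min => /andP[s1 s2] /andP[s3 s4].
have /dP {}dP : s \in `]t - d, t + d[ by rewrite in_itv /=; apply/andP; split; lra.
have /d'P {}d'P : s \in `]t - d', t + d'[ by rewrite in_itv /=; apply/andP; split; lra.
move: (dP Ts) (d'P Ts); rewrite sigE => h1 h2.
have ts0 : 0 < `|t - s| by rewrite normr_gt0 subr_eq0 eq_sym.
rewrite add0r -(ler_pM2r ts0) -normrM.
rewrite (_ : (l - m) * (t - s) = (f t - f s - m * (t - s)) -
  (f t - f s - l * (t - s))); last by ring.
apply: le_trans (ler_normB _ _) _; lra.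
Qed.

(** * Monotonicity from the sign of the derivative *)

(** For each k > 0 the inequality Z u <= Z t + k (t - u) propagates along the time
    scale. The slack k (t - u) absorbs the error at right-dense points; over jumps
    and at limits from the left it is kept as it stands. *)
Lemma nondecreasing_of_delta_derive (R : realType) (T : set R) (Z : R -> R)
    (u v : R) :
  closed T -> {within T, continuous Z} -> T u -> T v -> u <= v ->
  (forall t, T t -> u <= t -> t < v ->
     exists2 l, 0 <= l & is_delta_derive T Z t l) ->
  Z u <= Z v.
Proof.
move=> Tc /within_continuous_distP Zc Tu Tv uv dZ.
apply/ler_addgt0Pr => e e0.
have w0 : 0 < v - u + 1 by lra.
pose k := e / (v - u + 1).
have k0 : 0 < k by rewrite divr_gt0.
suff h : Z u <= Z v + k * (v - u).
  apply: (le_trans h); rewrite lerD2l /k mulrAC ler_pdivrMr // ler_pM2l //; lra.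
pattern v; apply: (@time_scale_ind R T u v _ Tc) => //.
- by rewrite subrr mulr0 addr0.
- move=> t Tt ut tv tsig At.
  have [l l0 Zl] := dZ t Tt ut tv.
  have := is_delta_derive_scatteredE Tt Zl.
  have : 0 <= l * (sigma T t - t) by rewrite mulr_ge0 //; lra.
  have : 0 <= k * (sigma T t - t) by rewrite mulr_ge0 //; lra.
  move: At; rewrite !mulrBr; lra.
- move=> t Tt ut tv sigE At.
  have [l l0 Zl] := dZ t Tt ut tv.
  have [d d0 dP] := Zl k k0; exists d => // s Ts ts sd _.
  have /dP : s \in `]t - d, t + d[ by rewrite in_itv /=; apply/andP; split; lra.
  move=> /(_ Ts); rewrite sigE -[t - s]opprB normrN [in leRHS]gtr0_norm ?subr_gt0//.
  rewrite ler_norml => /andP[_].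
  have : 0 <= l * (s - t) by rewrite mulr_ge0 //; lra.
  move: At; rewrite mulrN opprK !mulrBr; lra.
- move=> t Tt ut tv _ dense A_lt; rewrite leNgt; apply/negP => lt.
  have eta0 : 0 < Z u - (Z t + k * (t - u)) by rewrite subr_gt0.
  have [d d0 dP] := Zc t Tt _ eta0.
  have [|s [Ts ds st]] := dense (Num.min d (t - u)).
    by rewrite lt_min d0 subr_gt0.
  move: ds; rewrite ltrBlDr -ltrBlDl lt_min => /andP[sd su].
  have /dP : T s by [].
  have -> : `|s - t| < d by rewrite ltr_norml; apply/andP; split; lra.
  move=> /(_ isT); rewrite ltr_norml => /andP[_].
  have := A_lt s Ts _ st; have -> : u <= s by lra.
  move=> /(_ isT).
  have : k * (s - u) <= k * (t - u) by rewrite ler_pM2l //; lra.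
  lra.
Qed.

(** Dropping a right-dense point e costs nothing: the values on the two sides of
    e are linked by continuity, since points of T accumulate at e from the
    right. *)
Lemma nondecreasing_off_finite (R : realType) (T E : set R) (Z : R -> R)
    (u v : R) :
  closed T -> {within T, continuous Z} -> finite_set E ->
  E `<=` right_dense T ->
  (forall t, (kappa T `\` E) t -> exists2 l, 0 <= l & is_delta_derive T Z t l) ->
  T u -> T v -> u <= v -> Z u <= Z v.
Proof.
move=> Tc Zc /finite_seqP[r ->{E}] Erd dZ Tu Tv uv.
have {}dZ : forall t, T t -> u <= t -> t < v -> t \notin r ->
    exists2 l, 0 <= l & is_delta_derive T Z t l.
  by move=> t Tt _ tv /negP tr; apply: dZ; split=> //; exact: kappa_mem tv.
elim: r u v Tu Tv uv Erd dZ => [|x r IH] u v Tu Tv uv Erd dZ.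
  by apply: (@nondecreasing_of_delta_derive _ T) => // t Tt ut tv; exact: dZ.
have Erd' : [set` r] `<=` right_dense T.
  by move=> t /= tr; apply: Erd; rewrite /= inE tr orbT.
have [Tx sigx] : right_dense T x by apply: Erd; rewrite /= inE eqxx.
have [/andP[ux xv]|xuv] := boolP ((u <= x) && (x < v)); last first.
  apply: IH => // t Tt ut tv tr; apply: dZ => //; rewrite inE negb_or tr andbT.
  by apply: contraNneq xuv => <-; rewrite ut.
apply: (@le_trans _ _ (Z x)).
  apply: IH => // t Tt ut tx tr; apply: dZ => //; first lra.
  by rewrite inE negb_or tr lt_eqF.
have /within_continuous_distP Zd := Zc.
apply/ler_addgt0Pr => e e0; have [d d0 dP] := Zd x Tx e e0.
have [|s [Ts xs]] := @right_dense_approx _ T x v (Num.min d (v - x)) sigx Tv xv.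
  by rewrite lt_min d0 subr_gt0.
rewrite -ltrBlDl lt_min => /andP[sd sv].
have : Z s <= Z v.
  apply: IH => //; first lra.
  move=> t Tt st tv tr; apply: dZ => //; first lra.
  by rewrite inE negb_or tr gt_eqF //; lra.
have : `|Z s - Z x| < e.
  by apply: dP => //; rewrite ltr_norml; apply/andP; split; lra.
rewrite ltr_norml => /andP[]; lra.
Qed.

(** * Existence of antiderivatives *)

Lemma finite_set_bounded (R : realType) (E : set R) (g : R -> R) :
  finite_set E -> exists M, forall t, E t -> `|g t| <= M.
Proof.
move=> /finite_seqP[r ->{E}]; elim: r => [|x r [M MP]]; first by exists 0.
exists (Num.max `|g x| M) => t /=; rewrite inE le_max => /orP[/eqP ->|tr].
  by rewrite lexx.
by rewrite MP ?orbT.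
Qed.

Lemma finite_set_isolated (R : realType) (E : set R) (t : R) :
  finite_set E -> ~ E t -> exists2 d, 0 < d & forall s, E s -> d <= `|s - t|.
Proof.
move=> /finite_seqP[r ->{E}]; elim: r => [|x r IH] /=; first by exists 1.
rewrite inE => /negP; rewrite negb_or => /andP[tx /negP /IH[d d0 dP]].
exists (Num.min d `|x - t|).
  by rewrite lt_min d0 normr_gt0 subr_eq0 eq_sym.
move=> s; rewrite /= inE ge_min => /orP[/eqP ->|/dP ->//].
by rewrite lexx orbT.
Qed.

(** By induction along [u, v): continuity or a one-sided limit bounds g near each
    right-dense, left-dense or exceptional point. The finitely many exceptional
    values are bounded apart. *)
Lemma piecewise_rd_continuous_bounded (R : realType) (T D : set R)
    (g : R -> R) (u v : R) :
  closed T -> piecewise_rd_continuous T D g -> T u -> T v -> u <= v ->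
  exists M, forall t, T t -> u <= t -> t < v -> `|g t| <= M.
Proof.
move=> Tc [DT [finE rdE] gcont gleft gright] Tu Tv uv.
suff [M MP] : exists M, forall s, D s -> u <= s -> s < v -> `|g s| <= M.
  have [K KP] := finite_set_bounded g finE.
  exists (Num.max M K) => t Tt ut tv; rewrite le_max.
  have [Dt|nDt] := pselect (D t); first by rewrite MP.
  by rewrite KP ?orbT //; split=> //; exact: kappa_mem tv.
pattern v; apply: (@time_scale_ind R T u v _ Tc) => //.
- by exists 0 => s _ us su; move: (lt_le_trans su us); rewrite ltxx.
- move=> t Tt ut tv tsig [M MP]; exists (Num.max M `|g t|) => s Ds us ssig.
  have [st|st] := ltrP s t; first by rewrite le_max MP.
  have [ts|ts|<-] := ltrgtP t s; [|lra|by rewrite le_max lexx orbT].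
  by have [_] := sigma_between (kappa_sub (DT _ Ds)) ts; lra.
- move=> t Tt ut tv sigE [M MP].
  have [d d0 [K KP]] : exists2 d, 0 < d &
      exists K, forall s, D s -> t < s -> s < t + d -> `|g s| <= K.
    have [Dt|nDt] := pselect (D t).
      have /cvg_within_distP/(_ 1 ltr01)[d d0 dP] := gcont t Dt (conj Tt sigE).
      exists d => //; exists (`|g t| + 1) => s Ds ts sd.
      have : `|g s - g t| < 1.
        by apply: dP => //; rewrite ltr_norml; apply/andP; split; lra.
      by have := ler_normD (g s - g t) (g t); rewrite subrK; lra.
    have [l] := gright t (conj (kappa_mem Tt Tv tv) nDt).
    move=> /cvgrPdist_lt/(_ 1 ltr01); rewrite near_withinE /at_right near_withinE.
    move=> /nbhs_distP[d d0 dP]; exists d => //; exists (`|l| + 1) => s Ds ts sd.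
    have : `|l - g s| < 1.
      by apply: dP => //; rewrite ltr_norml; apply/andP; split; lra.
    by rewrite distrC; have := ler_normD (g s - l) l; rewrite subrK; lra.
  exists d => // s Ts ts sd sv.
  exists (Num.max M (Num.max K `|g t|)) => w Dw uw ws; rewrite !le_max.
  have [wt|tw|<-] := ltrgtP w t; first by rewrite MP.
    by rewrite KP ?orbT //; lra.
  by rewrite lexx !orbT.
- move=> t Tt ut tv ld dense A_lt.
  have [l] := gleft t ld.
  move=> /cvgrPdist_lt/(_ 1 ltr01); rewrite near_withinE /at_left near_withinE.
  move=> /nbhs_distP[d d0 dP].
  have [|s [Ts]] := dense (Num.min d (t - u)); first by rewrite lt_min d0 subr_gt0.
  rewrite ltrBlDr -ltrBlDl lt_min => /andP[sd su] st.
  have [|M MP] := A_lt s Ts _ st; first by lra.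
  exists (Num.max M (`|l| + 1)) => w Dw uw wt; rewrite le_max.
  have [ws|sw] := ltrP w s; first by rewrite MP.
  apply/orP; right.
  have : `|l - g w| < 1.
    by apply: dP => //; rewrite ltr_norml; apply/andP; split; lra.
  by rewrite distrC; have := ler_normD (g w - l) l; rewrite subrK; lra.
Qed.

(** The increments of U dominate all lower Darboux estimates of the integral of g
    over subintervals of [a, t]. *)
Definition majorant (R : realType) (T : set R) (g : R -> R) (a t : R) :
    set (R -> R) :=
  [set U | U a = 0 /\ forall u v m, T u -> T v -> u < v -> v <= t ->
     (forall r, T r -> u <= r -> r < v -> m <= g r) -> m * (v - u) <= U v - U u].

Definition lower_integral (R : realType) (T : set R) (g : R -> R) (a t : R) : R :=
  inf [set U t | U in majorant T g a t].

Lemma majorant_le (R : realType) (T : set R) (g : R -> R) (a s t : R) :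
  s <= t -> majorant T g a t `<=` majorant T g a s.
Proof.
move=> st U [U0 UP]; split=> // u v m Tu Tv uv vs; apply: UP => //; lra.
Qed.

(** With |g| <= M, the line of slope M through (a, 0) is a majorant, and no majorant
    goes below the line of slope -M. *)
Lemma majorant_has_inf (R : realType) (T : set R) (g : R -> R) (a b M t : R) :
  T a -> (forall t, T t -> a <= t <= b) ->
  (forall t, T t -> t < b -> `|g t| <= M) ->
  T t -> has_inf [set U t | U in majorant T g a t].
Proof.
move=> Ta Tab gM Tt; have /andP[at_ tb] := Tab t Tt; split.
  exists (M * (t - a)), (fun s => M * (s - a)) => //.
  split=> [|u v m Tu Tv uv vt mg]; first by rewrite subrr mulr0.
  rewrite -mulrBr opprB addrA subrK ler_pM2r ?subr_gt0 //.
  have := gM u Tu; have -> : u < b by lra.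
  move=> /(_ isT); rewrite ler_norml => /andP[_].
  by apply: le_trans; exact: mg.
exists (- M * (t - a)) => _ [U [U0 UP] <-].
have [ta|ta] := ltrP a t; last first.
  have -> : t = a by lra.
  by rewrite U0 subrr mulr0.
have := UP a t (- M) Ta Tt ta (lexx _); rewrite U0 subr0; apply => r Tr ar rt.
have := gM r Tr; have -> : r < b by lra.
by move=> /(_ isT); rewrite ler_norml => /andP[].
Qed.

(** The defining inequality of majorants passes to the infimum. *)
Lemma lower_integral_ge (R : realType) (T : set R) (g : R -> R)
    (a b M u v m : R) :
  T a -> (forall t, T t -> a <= t <= b) ->
  (forall t, T t -> t < b -> `|g t| <= M) ->
  T u -> T v -> u < v -> (forall r, T r -> u <= r -> r < v -> m <= g r) ->
  m * (v - u) <= lower_integral T g a v - lower_integral T g a u.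
Proof.
move=> Ta Tab gM Tu Tv uv mg; rewrite lerBrDr.
have hu := majorant_has_inf Ta Tab gM Tu.
have hv := majorant_has_inf Ta Tab gM Tv.
apply: lb_le_inf; first exact: hv.1.
move=> _ [U UP <-].
have : lower_integral T g a u <= U u.
  by apply: ge_inf; [exact: hu.2|exists U => //; apply: majorant_le UP; exact: ltW].
have := UP.2 u v m Tu Tv uv (lexx _) mg; lra.
Qed.

(** Continuing the infimum beyond s by a line of slope C gives a majorant up
    to t, which the infimum at t cannot exceed. *)
Lemma lower_integral_le (R : realType) (T : set R) (g : R -> R)
    (a b M s t C : R) :
  T a -> (forall t, T t -> a <= t <= b) ->
  (forall t, T t -> t < b -> `|g t| <= M) ->
  T s -> T t -> s < t -> (forall r, T r -> s <= r -> r < t -> g r <= C) ->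
  lower_integral T g a t - lower_integral T g a s <= C * (t - s).
Proof.
move=> Ta Tab gM Ts Tt st gC; rewrite lerBlDl.
set F := lower_integral T g a.
have Fge := lower_integral_ge Ta Tab gM.
pose U r := if r <= s then F r else F s + C * (r - s).
have <- : U t = F s + C * (t - s) by rewrite /U leNgt st.
apply: ge_inf; first by have [] := majorant_has_inf Ta Tab gM Tt.
exists U => //; split.
  have /andP[as_ _] := Tab s Ts; rewrite /U as_ /F /lower_integral.
  rewrite [X in inf X](_ : _ = [set 0]) ?inf1 //.
  apply/seteqP; split=> [_ [V [V0 _] <-//]|_ ->].
  have [[_ [V [V0 VP] _]] _] := majorant_has_inf Ta Tab gM Ta.
  by exists V.
move=> u v m Tu Tv uv vt mg; rewrite /U.
have [vs|sv] := lerP v s.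
  have -> : u <= s by lra.
  exact: Fge.
have [us|su] := lerP u s; last first.
  have : m <= C by apply: le_trans (mg u Tu (lexx _) uv) _; apply: gC => //; lra.
  have -> : F s + C * (v - s) - (F s + C * (u - s)) = C * (v - u) by ring.
  by rewrite ler_pM2r // subr_gt0.
(* The interval [u, v) contains s: compare with F on [u, s], with the line after s. *)
have mC : m <= C by apply: le_trans (mg s Ts us sv) _; apply: gC.
have h1 : m * (v - s) <= C * (v - s) by rewrite ler_pM2r // subr_gt0.
have h2 : m * (s - u) <= F s - F u.
  have [us'|su'] := ltrP u s; last first.
    have -> : u = s by lra.
    by rewrite !subrr mulr0.
  by apply: Fge => // r Tr ur rs; apply: mg => //; lra.
have -> : m * (v - u) = m * (v - s) + m * (s - u) by ring.
lra.
Qed.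

(** The increments of the lower integral over [u, v] lie between m (v - u) and
    C (v - u) for any bounds m, C of g on [u, v). On [t, sigma t) the only point is t,
    which gives the exact increment over a jump; near a right-dense t, continuity of
    g gives the bounds g(t) - e and g(t) + e. *)
Lemma delta_antiderivative_exists (R : realType) (T D : set R) (g : R -> R)
    (a b : R) :
  closed T -> T a -> T b -> (forall t, T t -> a <= t <= b) ->
  piecewise_rd_continuous T D g -> exists F, delta_antiderivative T g F.
Proof.
move=> Tc Ta Tb Tab gprd; have /andP[ab _] := Tab b Tb.
have [M0 M0P] := piecewise_rd_continuous_bounded Tc gprd Ta Tb ab.
pose M := `|M0| + 1.
have gM t : T t -> t < b -> `|g t| <= M.
  move=> Tt tb; have /andP[at_ _] := Tab t Tt.
  by have := M0P t Tt at_ tb; have := ler_norm M0; rewrite /M; lra.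
have M0' : 0 < M by rewrite /M; have := normr_ge0 M0; lra.
have Fge := lower_integral_ge Ta Tab gM.
have Fle := lower_integral_le Ta Tab gM.
set F := lower_integral T g a in Fge Fle.
have Flip u v : T u -> T v -> u < v -> `|F v - F u| <= M * (v - u).
  move=> Tu Tv uv.
  have gb r : T r -> r < v -> - M <= g r <= M.
    move=> Tr rv; rewrite -ler_norml; apply: gM => //.
    by have /andP[_ vb] := Tab v Tv; lra.
  rewrite ler_norml -mulNr; apply/andP; split.
    by apply: Fge => // r Tr ur rv; have /andP[] := gb r Tr rv.
  by apply: Fle => // r Tr ur rv; have /andP[] := gb r Tr rv.
have Fc : {within T, continuous F}.
  apply/within_continuous_distP => t Tt e e0.
  exists (e / M); first by rewrite divr_gt0.
  move=> s Ts; rewrite ltr_pdivlMr // mulrC => st.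
  apply: le_lt_trans st.
  have [st|ts|->] := ltrgtP s t.
  - by rewrite distrC; exact: Flip.
  - exact: Flip.
  - by rewrite subrr normr0 mulr0.
have [DT [finE rdE] gcont _ _] := gprd.
exists F; split=> //; exists (kappa T `\` D); split=> // t [kt nE].
have Tt := kappa_sub kt.
have Dt : D t by apply: contrapT => nDt; apply: nE.
have := sigma_ge T t; rewrite le_eqVlt => /orP[/eqP sigE|tsig]; last first.
  apply: is_delta_derive_scattered => //.
  have Tsig := sigma_mem Tc Tt.
  have rE r : T r -> t <= r -> r < sigma T t -> g r = g t.
    rewrite le_eqVlt => Tr /orP[/eqP ->//|tr]; have [_] := sigma_between Tr tr; lra.
  apply/eqP; rewrite eq_le Fle ?Fge //= => r Tr tr rs; by rewrite rE.
move=> e e0.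
have /cvg_within_distP/(_ e e0)[d d0 dP] := gcont t Dt (conj Tt (esym sigE)).
(* Continuity at t holds along D only, so exceptional points must be kept away. *)
have [d' d'0 d'P] := finite_set_isolated finE nE.
exists (Num.min d d'); first by rewrite lt_min d0.
move=> s Ts; rewrite in_itv /= => /andP[].
rewrite ltrBlDr -ltrBlDl -[s < _]ltrBlDl !lt_min => /andP[s1 s2] /andP[s3 s4].
rewrite -sigE.
have gb r w : T r -> T w -> r < w -> `|r - t| < d -> `|r - t| < d' ->
    g t - e <= g r <= g t + e.
  move=> Tr Tw rw rd rd'; rewrite -ler_distl; apply: ltW; apply: dP => //.
  apply: contrapT => nDr; have := d'P r (conj (kappa_mem Tr Tw rw) nDr); lra.
have [st|ts|->] := ltrgtP s t; last by rewrite !subrr mulr0 subrr normr0 mulr0.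
- have {}gb r : T r -> s <= r -> r < t -> g t - e <= g r <= g t + e.
    by move=> Tr sr rt; apply: (gb r t) => //; rewrite ltr_norml; apply/andP; split; lra.
  rewrite ler_distl.
  rewrite -mulrBl -mulrDl Fge ?Fle // => r Tr sr rt; by have /andP[] := gb r Tr sr rt.
- have {}gb r : T r -> t <= r -> r < s -> g t - e <= g r <= g t + e.
    by move=> Tr tr rs; apply: (gb r s) => //; rewrite ltr_norml; apply/andP; split; lra.
  rewrite [leLHS](_ : _ = `|F s - F t - g t * (s - t)|); last first.
    by rewrite -normrN; congr `| _ |; ring.
  rewrite ler_distl.
  rewrite -mulrBl -mulrDl Fge ?Fle // => r Tr tr rs; by have /andP[] := gb r Tr tr rs.
Qed.

(** * Calculus of antiderivatives *)

Lemma within_continuousDM (R : realType) (T : set R) (f g : R -> R) (k : R) :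
  {within T, continuous f} -> {within T, continuous g} ->
  {within T, continuous (fun s => f s + k * g s)}.
Proof.
move=> fc gc t; apply: cvgD; first exact: fc.
by apply: cvgM; [exact: cvg_cst|exact: gc].
Qed.

Lemma within_continuousM (R : realType) (T : set R) (f g : R -> R) :
  {within T, continuous f} -> {within T, continuous g} ->
  {within T, continuous (fun s => f s * g s)}.
Proof. by move=> fc gc t; apply: cvgM; [exact: fc|exact: gc]. Qed.

Lemma within_continuous_id (R : realType) (T : set R) :
  {within T, continuous (fun t : R => t)}.
Proof. by apply: continuous_subspaceT => t; exact: cvg_id. Qed.

Lemma delta_antiderivativeDM (R : realType) (T : set R) (f g F G : R -> R)
    (k : R) :
  delta_antiderivative T f F -> delta_antiderivative T g G ->
  delta_antiderivative T (fun t => f t + k * g t) (fun t => F t + k * G t).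
Proof.
move=> [Fc [E [finE rdE EF]]] [Gc [E' [finE' rdE' EG]]].
split; first exact: within_continuousDM.
exists (E `|` E'); split; first by rewrite finite_setU.
  by move=> t [/rdE|/rdE'].
move=> t [kt nE]; apply: is_delta_deriveD.
  by apply: EF; split=> // Et; apply: nE; left.
by apply: EG; split=> // Et; apply: nE; right.
Qed.

Lemma delta_antiderivative_congr (R : realType) (T E : set R)
    (f g F : R -> R) :
  finite_set E -> E `<=` right_dense T ->
  (forall t, (kappa T `\` E) t -> f t = g t) ->
  delta_antiderivative T f F -> delta_antiderivative T g F.
Proof.
move=> finE rdE fg [Fc [E' [finE' rdE' EF]]]; split=> //.
exists (E `|` E'); split; first by rewrite finite_setU.
  by move=> t [/rdE|/rdE'].
move=> t [kt nE]; rewrite -fg; last by split=> // Et; apply: nE; left.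
by apply: EF; split=> // Et; apply: nE; right.
Qed.

Lemma delta_antiderivative_le (R : realType) (T : set R) (f F : R -> R)
    (u v : R) :
  closed T -> delta_antiderivative T f F -> (forall t, 0 <= f t) ->
  T u -> T v -> u <= v -> F u <= F v.
Proof.
move=> Tc [Fc [E [finE rdE EF]]] f0 Tu Tv uv.
apply: (@nondecreasing_off_finite _ T E) => // t kt.
by exists (f t) => //; exact: EF.
Qed.

Lemma delta_antiderivative0 (R : realType) (T : set R) (F : R -> R) (u v : R) :
  closed T -> delta_antiderivative T (fun=> 0) F ->
  T u -> T v -> u <= v -> F u = F v.
Proof.
move=> Tc F0 Tu Tv uv; apply/eqP; rewrite eq_le.
rewrite (delta_antiderivative_le Tc F0) //=.
have := delta_antiderivativeDM (-2) F0 F0.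
under eq_fun do rewrite mulr0 addr0.
by move=> /(delta_antiderivative_le Tc)/(_ (fun=> lexx _) Tu Tv uv); lra.
Qed.

Lemma delta_integralE (R : realType) (T : set R) (f F : R -> R) (c d : R) :
  closed T -> T c -> T d -> c <= d -> delta_antiderivative T f F ->
  delta_integral T f c d = F d - F c.
Proof.
move=> Tc Tcc Td cd Ff; apply: xget_unique; first by exists F.
move=> _ [G Gf ->]; have := delta_antiderivativeDM (-1) Ff Gf.
under eq_fun do rewrite mulN1r subrr.
by move=> /(delta_antiderivative0 Tc)/(_ Tcc Td cd); lra.
Qed.

Lemma delta_antiderivative_id (R : realType) (T : set R) :
  delta_antiderivative T (fun=> 1) id.
Proof.
split; first exact: within_continuous_id.
by exists set0; split=> // t _; exact: is_delta_derive_id.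
Qed.

Lemma delta_antiderivativeMid (R : realType) (T : set R) (f F : R -> R) :
  delta_antiderivative T f F ->
  delta_antiderivative T (fun t => F (sigma T t) + t * f t) (fun t => t * F t).
Proof.
move=> [Fc [E [finE rdE EF]]]; split.
  by apply: within_continuousM => //; exact: within_continuous_id.
by exists E; split=> // t /EF; exact: is_delta_deriveMid.
Qed.

Lemma C1prd_delta_antiderivative (R : realType) (T : set R) (y : R -> R) :
  C1prd T y -> delta_antiderivative T (delta_derive T y) y.
Proof.
move=> [yc finE [_ [_ rdE] _ _ _]]; split=> //.
exists (kappa T `\` delta_differentiable T y); split=> // t [kt nE].
have [_ ex] : delta_differentiable T y t by apply: contrapT => nD; apply: nE.
exact: xgetPex ex.
Qed.

(** * The variational problem *)

Lemma piecewise_rd_continuous_sqr (R : realType) (T D : set R) (g : R -> R) :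
  piecewise_rd_continuous T D g ->
  piecewise_rd_continuous T D (fun t => g t ^+ 2).
Proof.
move=> [DT finE gcont gleft gright]; split=> //.
- by move=> t Dt rdt; apply: cvgM; exact: gcont.
- by move=> t /gleft[l gl]; exists (l * l); apply: cvgM.
- by move=> t /gright[l gl]; exists (l * l); apply: cvgM.
Qed.

Lemma is_delta_derive_affine (R : realType) (T : set R) (c d t : R) :
  is_delta_derive T (fun s => c * s + d) t c.
Proof.
move=> e e0; exists 1 => // s _ _.
rewrite [leLHS](_ : _ = `|0 : R|); last by congr `| _ |; ring.
by rewrite normr0 mulr_ge0 // ltW.
Qed.

Lemma delta_derive_affine (R : realType) (T : set R) (c d t u v : R) :
  closed T -> T u -> T v -> u < v -> kappa T t ->
  delta_derive T (fun s => c * s + d) t = c.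
Proof.
move=> Tc Tu Tv uv kt; apply: xget_unique.
  exact: is_delta_derive_affine.
move=> l /= hl; apply: (is_delta_derive_unique Tc Tu Tv uv kt hl).
exact: is_delta_derive_affine.
Qed.

Lemma C1prd_affine (R : realType) (T : set R) (c d u v : R) :
  closed T -> T u -> T v -> u < v -> C1prd T (fun s => c * s + d).
Proof.
move=> Tc Tu Tv uv.
have dE t := @delta_derive_affine R T c d t u v Tc Tu Tv uv.
have DE : delta_differentiable T (fun s => c * s + d) = kappa T.
  apply/seteqP; split=> [t []//|t kt]; split=> //.
  by exists c; exact: is_delta_derive_affine.
have cvg_c F : Filter F ->
    delta_derive T (fun s => c * s + d) s @[s --> within (kappa T) F] --> c.
  by move=> FF; apply: cvg_near_cst; rewrite near_withinE; apply: nearW.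
split; [|by rewrite DE setDv|rewrite DE; split=> //].
- apply: continuous_subspaceT => t; apply: cvgD; last exact: cvg_cst.
  by apply: cvgM; [exact: cvg_cst|exact: cvg_id].
- by rewrite setDv; split.
- by move=> t kt _; rewrite dE //; exact: cvg_c.
- by move=> t _; exists c; exact: cvg_c.
- by move=> t _; exists c; exact: cvg_c.
Qed.

(** The witness is Z = H - 2 c y + c^2 t with H an antiderivative of the square of
    the derivative of y: completing the square costs only boundary terms, which are
    the same for all admissible functions. *)
Lemma cost_excess (R : realType) (T : set R) (a b alpha beta c : R)
    (y : R -> R) :
  closed (ts_interval T a b) -> T a -> T b -> a < b ->
  beta - alpha = c * (b - a) -> admissible T a b alpha beta y ->
  exists2 Z,
    delta_antiderivative (ts_interval T a b)
      (fun t => (delta_derive (ts_interval T a b) y t - c) ^+ 2) Z &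
    cost T a b y =
      c ^+ 2 * (b - a) + (b * beta - a * alpha) + (Z b - Z a).
Proof.
move=> Ic Ta Tb ab cE [yC1 ya yb]; rewrite /cost; set I := ts_interval T a b.
have Ia : I a by split=> //=; rewrite in_itv /= lexx ltW.
have Ib : I b by split=> //=; rewrite in_itv /= lexx ltW.
have Iab t : I t -> a <= t <= b by case=> _ /=; rewrite in_itv.
have yA := C1prd_delta_antiderivative yC1.
have [_ _ /piecewise_rd_continuous_sqr prd2] := yC1.
have [H HA] := delta_antiderivative_exists Ic Ia Ib Iab prd2.
exists (fun t => H t + (- (2 * c)) * y t + c ^+ 2 * t).
  have := delta_antiderivativeDM (c ^+ 2)
    (delta_antiderivativeDM (- (2 * c)) HA yA) (delta_antiderivative_id I).
  by congr delta_antiderivative; apply/funext => t; ring.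
have := delta_antiderivativeDM 1 HA (delta_antiderivativeMid yA).
under eq_fun do rewrite mul1r addrA.
move=> /(delta_integralE Ic Ia Ib (ltW ab)) ->.
rewrite ya yb (_ : beta = alpha + c * (b - a)); last by rewrite -cE; ring.
ring.
Qed.

Theorem mainTheorem2 (R : realType) (T : set R) (a b alpha beta : R)
    (hT : time_scale T) (ha : T a) (hb : T b) (hab : a < b)
    (hne : alpha <> beta) :
  is_global_minimizer (ts_interval T a b)
    (admissible T a b alpha beta) (cost T a b)
    (fun t : R =>
       (alpha - beta) / (a - b) * t + (beta * a - b * alpha) / (a - b)).
Proof.
have ba0 : b - a != 0 by rewrite subr_eq0 gt_eqF.
have ab0 : a - b != 0 by rewrite subr_eq0 lt_eqF.
set c := (alpha - beta) / (a - b); set d := (beta * a - b * alpha) / (a - b).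
set I := ts_interval T a b.
have cE : beta - alpha = c * (b - a) by rewrite /c; field.
have Ic : closed I.
  by apply: closedI; [exact: hT.2|exact: itv_closed].
have Ia : I a by split=> //=; rewrite in_itv /= lexx ltW.
have Ib : I b by split=> //=; rewrite in_itv /= lexx ltW.
have Iab t : I t -> a <= t <= b by case=> _ /=; rewrite in_itv.
have x0adm : admissible T a b alpha beta (fun t => c * t + d).
  split; first exact: C1prd_affine Ic Ia Ib hab.
  - by rewrite /c /d; field.
  - by rewrite /c /d; field.
have x0cost : cost T a b (fun t => c * t + d) =
    c ^+ 2 * (b - a) + (b * beta - a * alpha).
  have [Z ZA ->] := cost_excess Ic ha hb hab cE x0adm.
  rewrite (_ : Z b = Z a) ?subrr ?addr0 //; apply/esym.
  apply: (delta_antiderivative0 Ic _ Ia Ib (ltW hab)).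
  apply: (@delta_antiderivative_congr _ _ set0) ZA => // t [kt _].
  by rewrite (delta_derive_affine c d Ic Ia Ib hab kt) subrr expr0n.
split.
  split=> // y yadm; rewrite x0cost.
  have [Z ZA ->] := cost_excess Ic ha hb hab cE yadm.
  rewrite lerDl subr_ge0.
  by apply: (delta_antiderivative_le Ic ZA _ Ia Ib (ltW hab)) => t; exact: sqr_ge0.
move=> y [yadm ymin] t It; have /andP[at_ tb] := Iab t It.
have [Z ZA yE] := cost_excess Ic ha hb hab cE yadm.
have Zba : Z b <= Z a by have := ymin _ x0adm; rewrite yE x0cost; lra.
have Zle := delta_antiderivative_le Ic ZA (fun=> sqr_ge0 _).
have Zcst s : I s -> Z s = Z a.
  move=> Is; have /andP[as_ sb] := Iab s Is.
  by have := Zle a s Ia Is as_; have := Zle s b Is Ib sb; lra.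
have [Zc [E [finE rdE EZ]]] := ZA.
(* Equal end values make the nondecreasing Z constant, so its derivative is 0. *)
have dy s : (kappa I `\` E) s -> delta_derive I y s - c = 0.
  move=> [ks nE]; apply/eqP; rewrite -sqrf_eq0; apply/eqP.
  apply: (is_delta_derive_unique Ic Ia Ib hab ks); first exact: EZ.
  move=> e e0; exists 1 => // r Ir _.
  rewrite !Zcst //; last by apply: sigma_mem => //; exact: kappa_sub.
  by rewrite mul0r subr0 subrr normr0 mulr_ge0 // ltW.
have [yC1 ya _] := yadm.
have := delta_antiderivativeDM (- c) (C1prd_delta_antiderivative yC1)
  (delta_antiderivative_id I).
move=> /(@delta_antiderivative_congr _ _ E _ (fun=> 0) _ finE rdE).
have h : forall s, (kappa I `\` E) s -> delta_derive I y s + - c * 1 = 0.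
  by move=> s /dy; rewrite mulr1.
move=> /(_ h)/(delta_antiderivative0 Ic)/(_ Ia It at_) /=.
rewrite ya => yt.
have -> : y t = alpha - c * a + c * t by rewrite mulNr in yt; lra.
by rewrite /c /d; field.
Qed.
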